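(* Let $D$ be a digraph, let $S\subseteq V(D)$, and denote the (vertex sets of the) strong components of the induced subdigraph $\langle S\rangle$ by $S_1,\ldots,S_r$. Then $S$ is a general position set of $D$ if and only if all of the following hold: (1) each strong component $S_i$ induces a complete digraph; (2) $\{S_1,\ldots,S_r\}$ is distance-constant, i.e. for any $i,j\in\{1,\ldots,r\}$ with $i\ne j$ we have $d(u,v)=d(u',v')$ for all $u,u'\in S_i$ and $v,v'\in S_j$ (this distance is allowed to be infinite); (3) for no pairwise distinct $i,j,k\in\{1,\ldots,r\}$ is it the case that $$d(S_i,S_k)=d(S_i,S_j)+d(S_j,S_k)<\infty .$$
   Context: A digraph is a finite simple directed graph: no loops and no repeated arcs in the same direction, but both $u\to v$ and $v\to u$ may be present. $d(u,v)$ is the length of a shortest directed path from $u$ to $v$ in $D$, and $\infty$ if none exists. For vertex subsets $W,W'$, $d(W,W')$ is the length of a shortest path in $D$ starting in $W$ and ending in $W'$ ($\infty$ if there is none). $\langle S\rangle$ is the subdigraph of $D$ induced by $S$. A strong component is a maximal strongly connected subdigraph. A complete digraph has both arcs $u\to v$, $v\to u$ for every pair of distinct vertices (a single vertex is complete). A set $S\subseteq V(D)$ is in general position (a general position set) if for any $u,v\in S$ no shortest directed $u,v$-path in $D$ passes through a vertex of $S\setminus\{u,v\}$. *)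

(* Defs.v *)
From mathcomp Require Import all_boot all_order all_algebra.
From mathcomp Require Import constructive_ereal.

Set Implicit Arguments.
Unset Strict Implicit.
Unset Printing Implicit Defensive.

Import Order.TTheory GRing.Theory Num.Theory.

(* The vertex set is a subset of an ambient finite type, so that a digraph, its
   induced subdigraphs and their strong components all have the same type. *)
Record digraph (V : finType) := Digraph {
  vset : {set V};
  arc : rel V;
  arc_vset : forall u v, arc u v -> (u \in vset) && (v \in vset);
  arc_irr : irreflexive arc }.

Section Digraphs.
Variable V : finType.
Implicit Types (D H C : digraph V) (W S : {set V}) (u v w : V) (p q : seq V).

Definition induced_arc D W : rel V :=
  fun u v => [&& u \in W, v \in W & arc D u v].

Fact induced_arc_vset D W u v :
  induced_arc D W u v -> (u \in vset D :&: W) && (v \in vset D :&: W).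
Proof. by case/and3P=> uW vW /arc_vset/andP[uD vD]; rewrite !inE uD vD uW vW. Qed.

Fact induced_arc_irr D W : irreflexive (induced_arc D W).
Proof. by move=> u; rewrite /induced_arc arc_irr !andbF. Qed.

Definition induced D W : digraph V :=
  Digraph (@induced_arc_vset D W) (@induced_arc_irr D W).

Definition subdigraph H D : Prop :=
  vset H \subset vset D /\ subrel (arc H) (arc D).

(* The directed path with successive vertices u :: p, from u to v; its length
   is size p. *)
Definition dipath D u p v : bool :=
  [&& u \in vset D, path (arc D) u p, last u p == v & uniq (u :: p)].

Definition shortest_dipath D u p v : Prop :=
  dipath D u p v /\ forall q, dipath D u q v -> size p <= size q.

Definition dipath_of_length D W W' (n : nat) : bool :=
  [exists u in W, [exists v in W', [exists p : n.-tuple V, dipath D u p v]]].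

(* The vertices of a path are distinct, so its length is less than #|V|; the
   minimum of the empty family is +oo. *)
Definition set_dist D W W' : \bar int :=
  \big[mine/+oo%E]_(n < #|V| | dipath_of_length D W W' n) (n%:Z)%:E.

Definition dist D u v : \bar int := set_dist D [set u] [set v].

Definition strongly_connected D : Prop :=
  vset D != set0 /\
  forall u v, u \in vset D -> v \in vset D -> exists p, dipath D u p v.

Definition strong_component D C : Prop :=
  [/\ subdigraph C D, strongly_connected C &
      forall H, subdigraph H D -> strongly_connected H ->
        subdigraph C H -> subdigraph H C].

Definition strong_component_vset D W : Prop :=
  exists2 C, strong_component D C & vset C = W.

Definition complete D : Prop :=
  forall u v, u \in vset D -> v \in vset D -> u != v -> arc D u v.

Definition distance_constant D (F : {set V} -> Prop) : Prop :=
  forall W W', F W -> F W' -> W != W' ->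
  forall u u' v v', u \in W -> u' \in W -> v \in W' -> v' \in W' ->
    dist D u v = dist D u' v'.

Definition general_position D S : Prop :=
  forall u v, u \in S -> v \in S ->
  forall p, shortest_dipath D u p v ->
    ~ exists2 w, w \in u :: p & w \in S :\: [set u; v].

Lemma dipath_of_lengthP D W W' n :
  reflect (exists u p v, [/\ u \in W, v \in W', dipath D u p v & size p = n])
          (dipath_of_length D W W' n).
Proof.
apply: (iffP existsP) => [[u /andP[uW /existsP[v /andP[vW' /existsP[p Dp]]]]]|].
  by exists u, p, v; rewrite size_tuple.
case=> u [p [v [uW vW' Dp sp]]]; exists u; rewrite uW /=; apply/existsP.
exists v; rewrite vW' /=; apply/existsP.
by exists (Tuple (introT eqP sp)).
Qed.

Lemma dipath_size D u p v : dipath D u p v -> size p < #|V|.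
Proof.
case/and4P=> _ _ _ Up; rewrite -[(size p).+1]/(size (u :: p)).
by rewrite -(card_uniqP Up) max_card.
Qed.

Lemma set_dist_le D W W' u p v : u \in W -> v \in W' -> dipath D u p v ->
  (set_dist D W W' <= ((size p)%:Z)%:E)%E.
Proof.
move=> uW vW' Dp; have ltp := dipath_size Dp.
rewrite /set_dist (bigD1 (Ordinal ltp)) /= ?ge_min ?lexx //.
by apply/dipath_of_lengthP; exists u, p, v.
Qed.

Lemma set_dist_attained D W W' :
  set_dist D W W' = +oo%E \/
  exists u p v, [/\ u \in W, v \in W', dipath D u p v &
                    set_dist D W W' = ((size p)%:Z)%:E].
Proof.
rewrite /set_dist; elim/big_ind: _ => [|x y Hx Hy|n /dipath_of_lengthP].
- by left.
- by rewrite minEle; case: ifP.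
- by case=> u [p [v [uW vW' Dp sp]]]; right; exists u, p, v; rewrite sp.
Qed.

End Digraphs.

(* Main.v *)
Require Import Defs.
From mathcomp Require Import all_boot all_order all_algebra.
From mathcomp Require Import constructive_ereal.
From mathcomp Require Import zify.

(** General position is a statement about distances: a vertex [w] lies on some
    shortest path from [u] to [v] exactly when [d(u,v) = d(u,w) + d(w,v)] is
    finite, so [S] is in general position iff no such equality holds in [S] with
    [w] distinct from [u] and [v] ([general_positionP]).

    Suppose [S] is in general position. If [u -> w -> v] inside [S] and
    [u != v], then [u -> v], as otherwise [w] is the middle of a shortest path
    of length 2. Hence reachability in [<S>] between distinct vertices is
    adjacency ([general_position_connect]), which makes the strong components
    complete. If [u -> u'] in [S], then [d(u,v) <= 1 + d(u',v)], and equality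
    would put [u'] between [u] and [v]; so [d(u,v) <= d(u',v)]. Applied in both
    directions inside a component, this and its mirror image give
    distance-constancy, which in turn identifies the distance of two components
    with the distance of any representatives; condition (3) follows.

    Conversely, let [d(u,v) = d(u,w) + d(w,v)] be finite, with [w] distinct from
    [u] and [v]. Three different components contradict (3). If [u] and [v] share
    a component, then [d(u,v) <= 1] by completeness, while the sum is at least 2.
    If [w] shares its component with just one of [u] and [v], say [u], then
    [d(u,v) = d(w,v)] by (2), although [d(u,w) > 0]. *)

Set Implicit Arguments.
Unset Strict Implicit.
Unset Printing Implicit Defensive.

Import Order.TTheory GRing.Theory Num.Theory.

(* The name would otherwise denote the sub-arc of a cyclic sequence. *)
Local Notation arc := Defs.arc.

(** Distances are either [+oo] or path lengths of this form, so that their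
    arithmetic reduces to that of natural numbers. *)
Local Notation "n %:L" := ((n%:Z)%:E)%E (at level 2, format "n %:L").

Fact lee_len (m n : nat) : (m%:L <= n%:L)%E = (m <= n).
Proof. by rewrite lee_fin lez_nat. Qed.

Fact adde_len (m n : nat) : (m%:L + n%:L)%E = (m + n)%:L.
Proof. by rewrite -EFinD -PoszD. Qed.

(** * Distances and shortest paths *)

Section Distance.
Variables (V : finType) (D : digraph V).
Implicit Types (S W : {set V}) (u v w : V) (p q : seq V).

Lemma dist_attained u v :
  dist D u v = +oo%E \/
  exists2 p, dipath D u p v & dist D u v = (size p)%:L.
Proof.
rewrite /dist; have [->|[x [p [y [/set1P-> /set1P-> Dp ->]]]]] :=
  set_dist_attained D [set u] [set v]; first by left.
by right; exists p.
Qed.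

Lemma dist_le_dipath u p v :
  dipath D u p v -> (dist D u v <= (size p)%:L)%E.
Proof. by apply: set_dist_le; rewrite set11. Qed.

Lemma dist_le_walk u p : u \in vset D -> path (arc D) u p ->
  (dist D u (last u p) <= (size p)%:L)%E.
Proof.
move=> uD /shortenP[p' Dp' Up' sp'].
have szp : size p' <= size p by apply: uniq_leq_size => //; case/andP: Up'.
apply: (@le_trans _ _ (size p')%:L); last by rewrite lee_len; lia.
by apply: dist_le_dipath; rewrite /dipath uD Dp' eqxx Up'.
Qed.

(** A walk contains a path with the same ends on its own vertices, which is
    strictly shorter as soon as the walk repeats a vertex. *)
Lemma geodesic_walk_dipath u p : u \in vset D -> path (arc D) u p ->
  dist D u (last u p) = (size p)%:L -> dipath D u p (last u p).
Proof.
move=> uD Dp; rewrite /dipath uD Dp eqxx /=.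
case/shortenP: Dp => p' Dp' Up' sp' dE.
have szp : size p <= size p'.
  have := @dist_le_dipath u p' (last u p').
  by rewrite /dipath uD Dp' eqxx dE lee_len => /(_ Up').
have /= /andP[uNp' Up2] := Up'.
have [_ pE] := uniq_min_size Up2 sp' szp.
by rewrite -pE uNp' (leq_size_uniq Up2 sp' szp).
Qed.

Lemma shortest_dipathE u p v : shortest_dipath D u p v <->
  dipath D u p v /\ dist D u v = (size p)%:L.
Proof.
split=> [[Dp pmin]|[Dp dE]]; split=> //.
  have := dist_le_dipath Dp.
  have [->|[q /pmin szp ->]] := dist_attained u v; first by [].
  by rewrite lee_len => szq; congr _%:L; lia.
by move=> q /dist_le_dipath; rewrite dE lee_len; lia.
Qed.

Lemma dist_triangle u w v : (dist D u v <= dist D u w + dist D w v)%E.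
Proof.
have [->|[p Dp ->]] := dist_attained u w.
  by have [->|[q _ ->]] := dist_attained w v; rewrite /= leey.
have [->|[q Dq ->]] := dist_attained w v; first by rewrite /= leey.
case/and4P: Dp => uD Pp /eqP lp _; case/and4P: Dq => _ Pq /eqP lq _.
have := @dist_le_walk u (p ++ q) uD.
rewrite cat_path Pp lp Pq last_cat lp lq => /(_ isT) /le_trans-> //.
by rewrite adde_len lee_len size_cat; lia.
Qed.

Lemma dist_add_finite u w v x : (dist D u w + dist D x v < +oo)%E ->
  exists p q, [/\ dipath D u p w, dipath D x q v,
    dist D u w = (size p)%:L & dist D x v = (size q)%:L].
Proof.
have [->|[p Dp ->]] := dist_attained u w.
  by have [->|[q _ ->]] := dist_attained x v.
have [->|[q Dq ->]] := dist_attained x v; first by [].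
by move=> _; exists p, q.
Qed.

Lemma dist_ge1 u v : u != v -> (1%:L <= dist D u v)%E.
Proof.
have [->|[[|x p] Dp ->]] := dist_attained u v; first by rewrite leey.
  by case/and4P: Dp => _ _ /= -> _.
by rewrite lee_len.
Qed.

Lemma dist_arc u v : arc D u v -> dist D u v = 1%:L.
Proof.
move=> uv; have [uD _] := andP (arc_vset uv).
have nuv : u != v by apply: contraTneq uv => ->; rewrite arc_irr.
apply/le_anti; rewrite dist_ge1 // andbT.
by apply: (@dist_le_walk u [:: v]) => //=; rewrite uv.
Qed.

Lemma arc_dist u v : u != v -> (dist D u v <= 1%:L)%E -> arc D u v.
Proof.
move=> nuv; have [->|[p Dp ->]] := dist_attained u v; first by [].
rewrite lee_len; case/and4P: Dp => _; case: p => [|x [|y p]] //=.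
  by rewrite (negPf nuv).
by rewrite andbT => ux /eqP <-.
Qed.

(** What distance-constancy is for: the distance of two components may be
    computed on representatives. *)
Lemma set_dist_constant W W' u v : u \in W -> v \in W' ->
  (forall x y, x \in W -> y \in W' -> dist D x y = dist D u v) ->
  set_dist D W W' = dist D u v.
Proof.
move=> uW vW' dE; apply/le_anti/andP; split.
  have [->|[p Dp ->]] := dist_attained u v; first by rewrite leey.
  exact: set_dist_le Dp.
have [->|[x [p [y [xW yW' Dp ->]]]]] := set_dist_attained D W W'.
  by rewrite leey.
by rewrite -(dE x y) // dist_le_dipath.
Qed.

(** The metric form of general position: [w] can be inserted into a shortest
    path precisely when the triangle inequality through [w] is an equality. For
    [u = v] both sides are vacuous, the trivial path being the only path from a
    vertex to itself. *)
Lemma general_positionP S : general_position D S <->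
  forall u w v, u \in S -> w \in S -> v \in S -> u != w -> w != v ->
    ~ (dist D u v = (dist D u w + dist D w v)%E /\
       (dist D u w + dist D w v < +oo)%E).
Proof.
split=> [gpS u w v uS wS vS nuw nwv [dE]|btwS u v uS vS p].
  case/dist_add_finite=> p [q [Dp Dq dp dq]]; rewrite dp dq in dE.
  case/and4P: Dp => uD Pp /eqP lp _; case/and4P: Dq => _ Pq /eqP lq _.
  have lpq : last u (p ++ q) = v by rewrite last_cat lp.
  have dpq : dist D u v = (size (p ++ q))%:L.
    by rewrite dE adde_len size_cat.
  apply: (gpS u v uS vS (p ++ q)).
    apply/shortest_dipathE; split=> //; rewrite -{1}lpq.
    by apply: geodesic_walk_dipath; rewrite ?lpq // cat_path Pp lp.
  exists w; last by rewrite !inE wS negb_or eq_sym nuw nwv.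
  by rewrite -cat_cons mem_cat -lp mem_last.
case/shortest_dipathE => Dp dE [w wp].
rewrite !inE negb_or => /andP[/andP[nwu nwv] wS].
have{wp} wp : w \in p by move: wp; rewrite inE (negPf nwu).
apply: (btwS u w v) => //; first by rewrite eq_sym.
case/splitPr: wp Dp dE => p1 p2 /and4P[uD Pp /eqP lp _] dE.
move: Pp lp; rewrite cat_path last_cat /= => /and3P[Pp1 lw Pp2] lp.
have wD : w \in vset D by have [] := andP (arc_vset lw).
have d1 := @dist_le_walk u (rcons p1 w) uD.
rewrite rcons_path Pp1 lw last_rcons size_rcons in d1.
have d2 := dist_le_walk wD Pp2; rewrite lp in d2.
have := dist_triangle u w v; move: {d1}(d1 isT) d2; rewrite dE size_cat /=.
have [->|[q1 _ ->]] := dist_attained u w; first by [].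
have [->|[q2 _ ->]] := dist_attained w v; first by [].
rewrite adde_len !lee_len ltry => le1 le2 le3; split=> //.
by congr _%:L; lia.
Qed.

End Distance.

(** * Strong components as classes of mutual reachability *)

Section StrongComponents.
Variables (V : finType) (H : digraph V).
Implicit Types (C : digraph V) (W : {set V}) (x y z : V).

Definition strong_class x :=
  [set y in vset H | connect (arc H) x y && connect (arc H) y x].

Lemma dipath_connect C x p y :
  subdigraph C H -> dipath C x p y -> connect (arc H) x y.
Proof.
case=> _ sCH /and4P[_ Pp /eqP <- _]; apply/connectP.
by exists p; rewrite // (sub_path sCH).
Qed.

(** This gives both the maximality of the class and, conversely, the fact that a
    maximal strongly connected subdigraph spans a class. *)
Lemma sub_strong_class C x : subdigraph C H -> strongly_connected C ->
  x \in vset C -> subdigraph C (induced H (strong_class x)).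
Proof.
move=> sCH [_ connC] xC; have [sVCH sACH] := sCH.
have sub y : y \in vset C -> y \in strong_class x.
  move=> yC; rewrite inE (subsetP sVCH) //=.
  have [[p Dp] [q Dq]] := (connC _ _ xC yC, connC _ _ yC xC).
  by rewrite (dipath_connect sCH Dp) (dipath_connect sCH Dq).
split=> [|y z yz]; first by apply/subsetP=> y yC; rewrite inE (subsetP sVCH) ?sub.
by have [yC zC] := andP (arc_vset yz); rewrite /= /induced_arc !sub // sACH.
Qed.

(** Every vertex on the way is reachable from the start of the walk and reaches
    its end, hence lies in the class as well. *)
Lemma strong_class_path x y p : path (arc H) y p -> y \in strong_class x ->
  last y p \in strong_class x -> path (arc (induced H (strong_class x))) y p.
Proof.
elim: p y => //= z p IHp y /andP[yz Pp] yx lx.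
have zx : z \in strong_class x.
  move: yx lx; rewrite !inE => /and3P[_ xy _] /and3P[_ _ lx].
  have [_ ->] := andP (arc_vset yz).
  rewrite (connect_trans xy (connect1 yz)) (connect_trans _ lx) //.
  by apply/connectP; exists p.
by rewrite /induced_arc yx zx yz IHp.
Qed.

Lemma strongly_connected_class x :
  x \in vset H -> strongly_connected (induced H (strong_class x)).
Proof.
move=> xH; have xx : x \in strong_class x by rewrite inE xH connect0.
split=> [|y z]; first by apply/set0Pn; exists x; rewrite inE xH.
move=> yC /setIP[_ zx]; have /setIP[_ yx] := yC.
have /connectP[p0 Pp0 zE] : connect (arc H) y z.
  by move: yx zx; rewrite !inE => /and3P[_ _ yx] /and3P[_ /(connect_trans yx)].
rewrite {}zE in zx *; case/shortenP: (strong_class_path Pp0 yx zx) => p Pp Up _.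
by exists p; rewrite /dipath yC Pp eqxx Up.
Qed.

Lemma induced_subdigraph W : subdigraph (induced H W) H.
Proof. by split=> [|y z /and3P[]]; first exact: subsetIl. Qed.

Lemma strong_class_component x :
  x \in vset H -> strong_component_vset H (strong_class x).
Proof.
move=> xH; have xx : x \in strong_class x by rewrite inE xH connect0.
exists (induced H (strong_class x)); last first.
  by apply/setIidPr/subsetP=> y; rewrite inE => /andP[].
split; [exact: induced_subdigraph | exact: strongly_connected_class |].
move=> C sCH connC [sVC _]; apply: sub_strong_class => //.
by rewrite (subsetP sVC) // inE xH.
Qed.

Lemma component_strong_class W x :
  strong_component_vset H W -> x \in W -> W = strong_class x.
Proof.
case=> C [sCH connC maxC] <- xC.
have sCx := sub_strong_class sCH connC xC.
have xH : x \in vset H by case: sCH => /subsetP->.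
have [sxC _] := maxC _ (induced_subdigraph _) (strongly_connected_class xH) sCx.
apply/eqP; rewrite eqEsubset (subset_trans sCx.1) ?subsetIr //=.
apply: subset_trans sxC; apply/subsetP=> y yx.
by rewrite inE yx andbT; move: yx; rewrite inE => /andP[].
Qed.

Lemma component_nonempty W : strong_component_vset H W -> exists x, x \in W.
Proof. by case=> C [_ [/set0Pn]] + _ _ <-. Qed.

Lemma component_disjoint W W' x y : strong_component_vset H W ->
  strong_component_vset H W' -> W != W' -> x \in W -> y \in W' -> x != y.
Proof.
move=> cW cW' + xW yW'; apply: contraNneq => xy; rewrite -xy in yW'.
by rewrite (component_strong_class cW xW) (component_strong_class cW' yW').
Qed.

End StrongComponents.

(** * Arcs inside a general position set *)

Section GeneralPosition.
Variables (V : finType) (D : digraph V) (S : {set V}).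
Hypothesis gpS : general_position D S.
Implicit Types u v w : V.

(** Otherwise [u -> w -> v] would be a shortest path of length 2. *)
Lemma general_position_arc_trans u w v : u \in S -> w \in S -> v \in S ->
  arc D u w -> arc D w v -> u != v -> arc D u v.
Proof.
move=> uS wS vS uw wv nuv; apply: arc_dist => //.
have nuw : u != w by apply: contraTneq uw => ->; rewrite arc_irr.
have nwv : w != v by apply: contraTneq wv => ->; rewrite arc_irr.
have := (general_positionP D S).1 gpS u w v uS wS vS nuw nwv.
have := dist_triangle D u w v; rewrite (dist_arc uw) (dist_arc wv) adde_len.
have [->|[p _ ->]] := dist_attained D u v; first by [].
rewrite !lee_len ltry => le2 ne2.
have : size p <> 1 + 1 by move=> E; apply: ne2; rewrite E.
by lia.
Qed.

(** By transitivity of adjacency, a path inside [S] can be shortened from its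
    end until a single arc is left. *)
Lemma general_position_connect u v :
  connect (arc (induced D S)) u v -> u != v -> arc D u v.
Proof.
case/connectP=> p Pp ->; elim: p u Pp => [|w p IHp] u /=; first by rewrite eqxx.
case/andP=> /and3P[uS wS uw] Pp nul.
have lS : last w p \in S.
  elim: p w wS Pp {IHp uw nul} => //= x p IHp w _ /andP[/and3P[_ xS _] Pp].
  exact: IHp Pp.
have [<- //|nwl] := eqVneq w (last w p).
by apply: (general_position_arc_trans uS wS) => //; apply: IHp.
Qed.

(** The detour through [u'] has length [1 + d(u',v)] and is not shortest, so
    [d(u,v)] is smaller than that. *)
Lemma general_position_dist_source u u' v : u \in S -> u' \in S -> v \in S ->
  arc D u u' -> u' != v -> (dist D u v <= dist D u' v)%E.
Proof.
move=> uS u'S vS uu' nu'v.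
have nuu' : u != u' by apply: contraTneq uu' => ->; rewrite arc_irr.
have := (general_positionP D S).1 gpS u u' v uS u'S vS nuu' nu'v.
have := dist_triangle D u u' v; rewrite (dist_arc uu').
have [->|[q _ ->]] := dist_attained D u' v; first by rewrite leey.
rewrite adde_len; have [->|[p _ ->]] := dist_attained D u v; first by [].
rewrite !lee_len ltry => le2 ne2.
have : size p <> 1 + size q by move=> E; apply: ne2; rewrite E.
by lia.
Qed.

Lemma general_position_dist_target u v v' : u \in S -> v \in S -> v' \in S ->
  arc D v' v -> u != v' -> (dist D u v <= dist D u v')%E.
Proof.
move=> uS vS v'S v'v nuv'.
have nv'v : v' != v by apply: contraTneq v'v => ->; rewrite arc_irr.
have := (general_positionP D S).1 gpS u v' v uS v'S vS nuv' nv'v.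
have := dist_triangle D u v' v; rewrite (dist_arc v'v).
have [->|[q _ ->]] := dist_attained D u v'; first by rewrite leey.
rewrite adde_len; have [->|[p _ ->]] := dist_attained D u v; first by [].
rewrite !lee_len ltry => le2 ne2.
have : size p <> size q + 1 by move=> E; apply: ne2; rewrite E.
by lia.
Qed.

End GeneralPosition.

Theorem theorem2p16 (V : finType) (D : digraph V) (S : {set V})
    (sSD : S \subset vset D) :
  general_position D S <->
  [/\ (forall W : {set V}, strong_component_vset (induced D S) W ->
         complete (induced D W)),
      distance_constant D (strong_component_vset (induced D S)) &
      forall Wi Wj Wk : {set V},
        strong_component_vset (induced D S) Wi ->
        strong_component_vset (induced D S) Wj ->
        strong_component_vset (induced D S) Wk ->
        Wi != Wj -> Wj != Wk -> Wi != Wk ->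
        ~ (set_dist D Wi Wk = (set_dist D Wi Wj + set_dist D Wj Wk)%E /\
           (set_dist D Wi Wj + set_dist D Wj Wk < +oo)%E)].
Proof.
set H := induced D S; pose F := strong_component_vset H.
have VH : vset H = S by apply/setIidPr.
have FS W x : F W -> x \in W -> x \in S.
  move=> FW xW; move: (xW); rewrite (component_strong_class FW xW).
  by rewrite -VH inE => /andP[].
have dist_comp W W' u v : distance_constant D F -> F W -> F W' -> W != W' ->
    u \in W -> v \in W' -> set_dist D W W' = dist D u v.
  move=> dcF FW FW' nWW' uW vW'; apply: set_dist_constant => // x y xW yW'.
  exact: (dcF W W').
split=> [gpS|[complS dcF triF]].
- have arcF W u v : F W -> u \in W -> v \in W -> u != v -> arc D u v.
    move=> FW uW; rewrite (component_strong_class FW uW) inE => /and3P[_ uv _].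
    exact: (general_position_connect gpS).
  have dcF : distance_constant D F.
    (* By symmetry in the pairs, one inequality suffices. *)
    have dle W W' : F W -> F W' -> W != W' -> forall u u' v v', u \in W ->
        u' \in W -> v \in W' -> v' \in W' -> (dist D u v <= dist D u' v')%E.
      move=> FW FW' nWW' u u' v v' uW u'W vW' v'W'.
      have nW x y : x \in W -> y \in W' -> x != y.
        exact: (component_disjoint FW FW').
      have [uS u'S] := (FS W u FW uW, FS W u' FW u'W).
      have [vS v'S] := (FS W' v FW' vW', FS W' v' FW' v'W').
      apply: (@le_trans _ _ (dist D u' v)).
        have [-> //|nuu'] := eqVneq u u'.
        apply: (general_position_dist_source gpS); rewrite ?nW //.
        exact: (arcF W).
      have [-> //|nvv'] := eqVneq v v'.
      apply: (general_position_dist_target gpS); rewrite ?nW //.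
      by apply: (arcF W') => //; rewrite eq_sym.
    move=> W W' FW FW' nWW' u u' v v' uW u'W vW' v'W'.
    by apply/le_anti; rewrite !(dle W W').
  split=> // [W FW u v|Wi Wj Wk Fi Fj Fk nij njk nik].
    rewrite !inE => /andP[_ uW] /andP[_ vW] nuv.
    by rewrite /= /induced_arc uW vW (arcF W).
  have [x xi] := component_nonempty Fi; have [y yj] := component_nonempty Fj.
  have [z zk] := component_nonempty Fk.
  rewrite (dist_comp _ _ x z) // (dist_comp _ _ x y) // (dist_comp _ _ y z) //.
  apply: ((general_positionP D S).1 gpS).
  + exact: FS xi.
  + exact: FS yj.
  + exact: FS zk.
  + exact: component_disjoint Fi Fj nij xi yj.
  + exact: component_disjoint Fj Fk njk yj zk.
apply/general_positionP => u w v uS wS vS nuw nwv.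
pose cl := strong_class H.
have Fcl x : x \in S -> F (cl x) by rewrite -VH; apply: strong_class_component.
have xcl x : x \in S -> x \in cl x by rewrite inE VH connect0 => ->.
have dcl x y : x \in S -> y \in S -> cl x = cl y -> (dist D x y <= 1%:L)%E.
  move=> xS yS clE; have [->|nxy] := eqVneq x y.
    apply: (@le_trans _ _ (0%:L)); last by rewrite lee_len.
    by apply: (@dist_le_walk _ D y [::]); rewrite // (subsetP sSD).
  have := complS _ (Fcl x xS) x y; rewrite !inE.
  have /(_ x xS) := xcl; have := xcl y yS; rewrite -clE !inE => -> ->.
  rewrite !(subsetP sSD) // => /(_ isT isT nxy) /and3P[_ _ /dist_arc->].
  by rewrite lexx.
case=> dE fin; have [p [q [_ _ dp dq]]] := dist_add_finite fin.
have := dist_ge1 D nuw; have := dist_ge1 D nwv; rewrite dp dq !lee_len => q1 p1.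
have [Euv|nuv] := eqVneq (cl u) (cl v).
  have := dcl u v uS vS Euv; rewrite dE dp dq adde_len lee_len.
  by lia.
have [Euw|nuw'] := eqVneq (cl u) (cl w).
  have duv : dist D u v = dist D w v.
    have wu : w \in cl u by rewrite Euw xcl.
    exact: (dcF _ _ (Fcl u uS) (Fcl v vS) nuv _ _ _ _ (xcl u uS) wu
              (xcl v vS) (xcl v vS)).
  by move: dE; rewrite duv dp dq adde_len => -[]; lia.
have [Ewv|nwv'] := eqVneq (cl w) (cl v).
  have duv : dist D u v = dist D u w.
    have wv : w \in cl v by rewrite -Ewv xcl.
    exact: (dcF _ _ (Fcl u uS) (Fcl v vS) nuv _ _ _ _ (xcl u uS) (xcl u uS)
              (xcl v vS) wv).
  by move: dE; rewrite duv dp dq adde_len => -[]; lia.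
have dcl2 x y : x \in S -> y \in S -> cl x != cl y ->
    set_dist D (cl x) (cl y) = dist D x y.
  by move=> xS yS nxy; apply: dist_comp; rewrite ?xcl //; apply: Fcl.
apply: (triF _ _ _ (Fcl u uS) (Fcl w wS) (Fcl v vS) nuw' nwv' nuv).
by rewrite !dcl2.
Qed.
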